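(* Let $n\geq 3$ be an integer and let $p(z)=z^n+a_{n-1}z^{n-1}+a_{n-2}z^{n-2}+\ldots+a_1z+a_0$ be a monic polynomial with complex coefficients and $a_0\neq 0$. Set $a_n=1$ and $d_j=\frac{a_{n-j}}{a_0}$ for $j=0,1,\ldots,n-1$; if $n=3$, set $d_{-1}=0$. Let $\beta>0$ be defined by \[\begin{aligned} \frac{1}{\beta}={}& \cos^2 \frac{\pi}{n}+ \frac{1}{4} \left ( |d_{n-1}|+ \sqrt{(1+|d_{n-2}|)^2+ \sum_{j=0,\,j\neq n-2}^{n-1}|d_j|^2}\right)^2\\ &+ \frac{1}{2} \sqrt{(1+|d_{n-4}|)^2+ \sum_{j=0,\,j\neq n-4}^{n-3}|d_j|^2}. \end{aligned}\] If $z\in\mathbb{C}$ is any zero of $p$, then $|z|^2\geq \beta$. *)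

(* Defs.v *)
From HB Require Import structures.
From mathcomp Require Import all_boot all_order all_algebra.
From mathcomp Require Import all_classical all_reals all_analysis.
From mathcomp Require Import complex.

Set Implicit Arguments.
Unset Strict Implicit.
Unset Printing Implicit Defensive.
Import Order.TTheory GRing.Theory Num.Theory.

Local Open Scope ring_scope.
Local Open Scope complex_scope.

Notation normc := ComplexField.Normc.normc.

Section Bound.
Variables (R : realType) (n : nat) (p : {poly R[i]}).

(* The index is an integer because d_{n-4} is d_{-1} = 0 when n = 3.
   For Posz j the subtraction n - j is truncated; only j < n is used below. *)
Definition d (j : int) : R[i] :=
  match j with
  | Posz j => p`_(n - j) / p`_0
  | Negz _ => 0
  end.

Definition shifted_norm (k : int) (m : nat) : R :=
  Num.sqrt ((1 + normc (d k)) ^+ 2 +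
            \sum_(0 <= j < m | j%:Z != k) normc (d j%:Z) ^+ 2).

Definition inv_beta : R :=
  cos (pi / n%:R) ^+ 2
  + 4^-1 * (normc (d (n%:Z - 1)) + shifted_norm (n%:Z - 2) n) ^+ 2
  + 2^-1 * shifted_norm (n%:Z - 4) (n - 2).

End Bound.

(* Main.v *)
Require Import Defs.
From mathcomp Require Import all_boot all_order all_algebra.
From mathcomp Require Import all_classical all_reals all_analysis.
From mathcomp Require Import complex.
From mathcomp Require Import ring lra.

Set Implicit Arguments.
Unset Strict Implicit.
Unset Printing Implicit Defensive.
Import Order.TTheory GRing.Theory Num.Theory.

Local Open Scope ring_scope.
Local Open Scope complex_scope.

(* With [r = 1 / |z|] and [X_j = r^j], the vector [X] satisfies [r X <= C X]
   entrywise, where [C] is the companion matrix of the reversed polynomial with its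
   entries replaced by their moduli; hence [r^2 X <= C^2 X] and
   [r^2 <X, X> <= <X, C^2 X>]. Split [C = A + B], where [A] is a truncated shift and
   [B] contains the last row and the superdiagonal entry next to it, so that
   [C^2 = A^2 + B^2 + (A B + B A)]. The three terms of [1 / beta] bound the quadratic
   forms of these three operators: the first two because the numerical radius
   satisfies [w(T^2) <= w(T)^2], with [w(A) = cos (pi / n)], and the last
   because [A B + B A] has only one row plus one further entry. *)

(** * Quadratic forms of powers and of bordered matrices *)

Section QuadraticForms.
Variable R : realFieldType.
Implicit Types (x : nat -> R) (T : (nat -> R) -> nat -> R).

Definition linear_op T := forall a b x y j,
  T (fun k => a * x k + b * y k) j = a * T x j + b * T y j.

Definition quad_bounded n T c := forall x,
  `|\sum_(j < n) x j * T x j| <= c * \sum_(j < n) x j ^+ 2.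

(* With [y = c x + T x] and [z = c x - T x] one has
   [2 c <x, (c^2 - T^2) x> = <y, (c - T) y> + <z, (c + T) z>], and both terms on
   the right are nonnegative. *)
Lemma quad_power_ineq n T c x : 0 < c -> linear_op T -> quad_bounded n T c ->
  \sum_(j < n) x j * T (T x) j <= c ^+ 2 * \sum_(j < n) x j ^+ 2.
Proof.
move=> c0 linT bT.
pose y k := c * x k + 1 * T x k; pose z k := c * x k + (-1) * T x k.
have hy : \sum_(j < n) y j * T y j <= c * \sum_(j < n) y j ^+ 2.
  by apply: le_trans (ler_norm _) (bT y).
have hz : - \sum_(j < n) z j * T z j <= c * \sum_(j < n) z j ^+ 2.
  by apply: le_trans (bT z); rewrite -normrN ler_norm.
suff E : 2 * c * (c ^+ 2 * (\sum_(j < n) x j ^+ 2)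
    - \sum_(j < n) x j * T (T x) j) =
    (c * (\sum_(j < n) y j ^+ 2) - \sum_(j < n) y j * T y j)
    + (c * (\sum_(j < n) z j ^+ 2) + \sum_(j < n) z j * T z j).
  rewrite -subr_ge0 -(@pmulr_rge0 _ (2 * c)) ?mulr_gt0// E; lra.
rewrite !mulr_sumr -!sumrB mulr_sumr -!big_split /=; apply: eq_bigr => j _.
by rewrite !linT /y /z; ring.
Qed.

(** [b] is the larger root of [4 b (b - t) = |v|^2], the top eigenvalue of the symmetrized matrix
    whose only nonzero row is [(v, t)]. For the upper bound, [4 b] times the gap is a sum of
    squares; the lower bound also uses [t >= 0]. *)
Lemma bordered_form_le m (v x : nat -> R) (a t b : R) :
  0 <= t -> 0 < b -> \sum_(k < m) v k ^+ 2 = 4 * b * (b - t) ->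
  `|a * (t * a + \sum_(k < m) v k * x k)| <= b * (a ^+ 2 + \sum_(k < m) x k ^+ 2).
Proof.
move=> t0 b0 hv.
have key (s : R) : s ^+ 2 = 1 -> s * (a * \sum_(k < m) v k * x k)
    <= b * (\sum_(k < m) x k ^+ 2) + (b - t) * a ^+ 2.
  move=> s2; rewrite -subr_ge0 -(@pmulr_rge0 _ (4 * b)) ?mulr_gt0//.
  have -> : 4 * b * (b * (\sum_(k < m) x k ^+ 2) + (b - t) * a ^+ 2
      - s * (a * (\sum_(k < m) v k * x k)))
      = \sum_(k < m) (2 * b * x k - s * a * v k) ^+ 2.
    have -> : \sum_(k < m) (2 * b * x k - s * a * v k) ^+ 2 =
      \sum_(k < m) (4 * b ^+ 2 * x k ^+ 2 + s ^+ 2 * a ^+ 2 * v k ^+ 2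
                    + (- 4 * b * s * a) * (v k * x k)).
      by apply: eq_bigr => k _; ring.
    by rewrite !big_split /= -!mulr_sumr hv s2; ring.
  by apply: sumr_ge0 => k _; exact: sqr_ge0.
have h1 := key 1 (expr1n _ _).
have h2 : - 1 * (a * \sum_(k < m) v k * x k)
    <= b * (\sum_(k < m) x k ^+ 2) + (b - t) * a ^+ 2.
  by apply: key; rewrite sqrrN expr1n.
have h3 : 0 <= t * a ^+ 2 by rewrite mulr_ge0 ?sqr_ge0.
by rewrite ler_norml; apply/andP; split; nra.
Qed.

End QuadraticForms.

(** * The quadratic form of a path *)

(* The positive eigenvector [sin ((j + 1) theta)] of the path gives the weights
   for the AM-GM inequality on each edge. *)
Lemma path_form_le_aux (R : realType) (theta : R) (y : nat -> R) (m : nat) :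
  (forall j, (j <= m)%N -> 0 < sin (j.+1%:R * theta)) ->
  \sum_(j < m) y j * y j.+1 <= cos theta * (\sum_(j < m) y j ^+ 2)
    + sin (m%:R * theta) / (2 * sin (m.+1%:R * theta)) * y m ^+ 2.
Proof.
elim: m => [|m IH] hs.
  by rewrite !big_ord0 mulr0 add0r mul0r sin0 !mul0r.
rewrite !big_ord_recr /=.
have {}IH := IH (fun j hj => hs j (leqW hj)).
have s1 := hs m (leqnSn m); have s2 := hs m.+1 (leqnn _).
set p := sin (m.+1%:R * theta) in IH s1 *.
set q := sin (m.+2%:R * theta) in s2 *.
(* This three-term recurrence turns the coefficient of [y m ^+ 2] in [IH] into
   [cos theta - q / (2 * p)], which leaves exactly the room that the new edge needs. *)
have Epq : sin (m%:R * theta) = 2 * cos theta * p - q.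
  have -> : m%:R * theta = m.+1%:R * theta - theta by rewrite -natr1; ring.
  have -> : q = sin (m.+1%:R * theta + theta).
    by rewrite /q; congr sin; rewrite -[in LHS]natr1; ring.
  by rewrite sinB sinD -/p; ring.
rewrite Epq in IH.
have am : y m * y m.+1 <= q / (2 * p) * y m ^+ 2 + p / (2 * q) * y m.+1 ^+ 2.
  have -> : q / (2 * p) * y m ^+ 2 + p / (2 * q) * y m.+1 ^+ 2
     = y m * y m.+1 + (q * y m - p * y m.+1) ^+ 2 / (2 * p * q).
    by field; rewrite !gt_eqF.
  by rewrite lerDl divr_ge0 ?sqr_ge0 // !mulr_ge0 ?ltW.
have E : (2 * cos theta * p - q) / (2 * p) = cos theta - q / (2 * p).
  by field; rewrite gt_eqF.
rewrite E in IH; lra.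
Qed.

(** At [theta = pi / m.+2%:R] the eigenvector vanishes just past the end of the path, so the last
    coefficient of the auxiliary bound is [cos theta] as well. *)
Lemma path_form_le (R : realType) (m : nat) (y : nat -> R) :
  \sum_(j < m) y j * y j.+1 <= cos (pi / m.+2%:R) * \sum_(j < m.+1) y j ^+ 2.
Proof.
set theta : R := pi / m.+2%:R.
have m0 : 0 < m.+2%:R :> R by rewrite ltr0n.
have t0 : 0 < theta by rewrite divr_gt0 ?pi_gt0.
have hs j : (j <= m)%N -> 0 < sin (j.+1%:R * theta).
  move=> jm; apply: sin_gt0_pi; rewrite mulr_gt0 ?ltr0n//=.
  by rewrite /theta mulrA ltr_pdivrMr// mulrC ltr_pM2l ?pi_gt0// ltr_nat.
apply: (le_trans (path_form_le_aux _ hs)).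
rewrite big_ord_recr mulrDr lerD2l /=; apply: ler_wpM2r; first exact: sqr_ge0.
have sm := hs m (leqnn m).
have -> : sin (m%:R * theta) = 2 * cos theta * sin (m.+1%:R * theta).
  have -> : m%:R * theta = m.+1%:R * theta - theta by rewrite -natr1; ring.
  have E : sin (m.+1%:R * theta + theta) = 0.
    have -> : m.+1%:R * theta + theta = pi.
      have -> : m.+1%:R * theta + theta = m.+2%:R * theta.
        by rewrite -[in RHS]natr1; ring.
      by rewrite /theta mulrC divfK ?gt_eqF.
    exact: sinpi.
  rewrite sinD in E; rewrite sinB.
  have -> : cos (m.+1%:R * theta) * sin theta = - (sin (m.+1%:R * theta) * cos theta).
    by lra.
  by ring.
have -> : 2 * cos theta * sin (m.+1%:R * theta) / (2 * sin (m.+1%:R * theta))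
  = cos theta by field; rewrite gt_eqF.
exact: lexx.
Qed.

(** * Splitting the companion matrix and its square *)

(* In the coordinates [x_j = w^j], the companion matrix of
   [w^(N+3) - \sum_k delta_k w^k] is the sum of [shift_op] and [border_op]; the
   latter consists of the last row and the rightmost superdiagonal entry. *)
Section CompanionSplitting.
Variables (R : realType) (N : nat) (delta : nat -> R).
Hypothesis delta_ge0 : forall k, 0 <= delta k.

Definition shift_op (x : nat -> R) (j : nat) : R :=
  if (j < N.+1)%N then x j.+1 else 0.

Definition border_op (x : nat -> R) (j : nat) : R :=
  if j == N.+1 then x N.+2
  else if j == N.+2 then \sum_(k < N.+3) delta k * x k else 0.

Lemma shift_op_linear : linear_op shift_op.
Proof.
by move=> a b x y j; rewrite /shift_op; case: ifP => _ //; rewrite !mulr0 addr0.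
Qed.

Lemma border_op_linear : linear_op border_op.
Proof.
move=> a b x y j; rewrite /border_op; case: ifP => _ //; case: ifP => _.
  by rewrite !mulr_sumr -big_split /=; apply: eq_bigr => k _; ring.
by rewrite !mulr0 addr0.
Qed.

(** The form lives on the path of the first [N.+2] coordinates, hence the angle. The last coordinate
    enters only on the right, where the cosine is nonnegative. *)
Lemma shift_op_bounded : quad_bounded N.+3 shift_op (cos (pi / N.+3%:R)).
Proof.
move=> x; rewrite [X in `|X|]big_ord_recr [X in `|X + _|]big_ord_recr /=.
rewrite /shift_op ltnn ltnNge leqnSn /= !mulr0 !addr0.
apply: (le_trans (ler_norm_sum _ _ _)).
have -> : \sum_(i < N.+1) `|x i * (if (i < N.+1)%N then x i.+1 else 0)|
    = \sum_(i < N.+1) `|x i| * `|x i.+1|.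
  by apply: eq_bigr => i _; rewrite ltn_ord normrM.
apply: (le_trans (path_form_le _ (fun i => `|x i|))).
rewrite [X in _ <= _ * X]big_ord_recr mulrDr /=.
have -> : \sum_(j < N.+2) `|x j| ^+ 2 = \sum_(j < N.+2) x j ^+ 2.
  by apply: eq_bigr => j _; rewrite real_normK ?num_real.
rewrite lerDl mulr_ge0 ?sqr_ge0//; apply: cos_ge0_pihalf.
have p0 := pi_gt0 R; apply/andP; split.
  by rewrite (@le_trans _ _ 0) ?oppr_le0 ?divr_ge0 ?ltW.
by rewrite ler_pM2l// lef_pV2 ?posrE ?ltr0n// ler_nat.
Qed.

(** In the quadratic form the superdiagonal entry merges with the last row, adding 1 to its entry
    [N.+1]. The constant is then the positive root required by [bordered_form_le]. *)
Lemma border_op_bounded :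
  quad_bounded N.+3 border_op
    (2^-1 * (delta N.+2 + Num.sqrt (delta N.+2 ^+ 2
       + \sum_(k < N.+2) (delta k + (k == N.+1 :> nat)%:R) ^+ 2))).
Proof.
set S := \sum_(k < N.+2) _; set t := delta N.+2; set b := 2^-1 * _.
have S1 : 1 <= S.
  rewrite /S big_ord_recr /= eqxx /= -[leLHS]add0r; apply: lerD.
    by apply: sumr_ge0 => k _; exact: sqr_ge0.
  by rewrite exprn_ege1 // lerDr.
have q0 : 0 < t ^+ 2 + S by rewrite ltr_wpDl ?sqr_ge0// (lt_le_trans _ S1).
have b0 : 0 < b by rewrite mulr_gt0// ltr_wpDl ?delta_ge0// sqrtr_gt0.
have hS : S = 4 * b * (b - t).
  have := sqr_sqrtr (ltW q0); rewrite /b; set s := Num.sqrt _ => E.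
  have -> : 4 * (2^-1 * (t + s)) * (2^-1 * (t + s) - t) = s ^+ 2 - t ^+ 2 by field.
  by rewrite E; ring.
move=> x.
have -> : \sum_(j < N.+3) x j * border_op x j =
   x N.+2 * (t * x N.+2 + \sum_(k < N.+2) (delta k + (k == N.+1 :> nat)%:R) * x k).
  rewrite [LHS]big_ord_recr [X in X + _ = _]big_ord_recr /=.
  rewrite big1; last first.
    by move=> i _; rewrite /border_op !ltn_eqF ?mulr0// ltnS ltnW.
  rewrite /border_op eqxx gtn_eqF// eqxx add0r.
  rewrite (big_ord_recr N.+2) /= (big_ord_recr N.+1) /=.
  rewrite (big_ord_recr N.+1) /= eqxx -/t.
  have -> : \sum_(i < N.+1) (delta i + (i == N.+1 :> nat)%:R) * x i =
     \sum_(i < N.+1) delta i * x i.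
    by apply: eq_bigr => i _; rewrite ltn_eqF// addr0.
  by rewrite -[true%:R]/(1 : R); ring.
rewrite [X in _ <= _ * X]big_ord_recr /= [X in _ <= _ * X]addrC.
apply: (@bordered_form_le _ N.+2 (fun k => delta k + (k == N.+1)%:R) x) => //.
exact: delta_ge0.
Qed.

(* When [N = 0] the extra entry of [A B + B A] is in column 0, which corresponds to
   [d_{-1} = 0]. *)
Let cross_row (k : nat) : R :=
  if k is k'.+1 then delta k' + (k == N)%:R else (N == 0)%:R.

(** [A B] only couples coordinates [N] and [N.+2], and [B A] is a last row with zero diagonal entry.
    Together they form a bordered form with [t = 0] and [b = s / 2]. *)
Lemma cross_form_le (s : R) (x : nat -> R) : 0 < s ->
  s ^+ 2 = (N == 0)%:R + \sum_(k < N.+1) (delta k + (k.+1 == N)%:R) ^+ 2 ->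
  \sum_(j < N.+3) x j * (shift_op (border_op x) j + border_op (shift_op x) j)
    <= 2^-1 * s * \sum_(j < N.+3) x j ^+ 2.
Proof.
move=> s0 hs.
have hv : \sum_(k < N.+2) cross_row k ^+ 2 = 4 * (2^-1 * s) * (2^-1 * s - 0).
  have -> : 4 * (2^-1 * s) * (2^-1 * s - 0) = s ^+ 2 by field.
  rewrite hs big_ord_recl /=; congr (_ + _); by case: (N == 0)%N;
      rewrite ?expr1n ?expr0n.
have -> : \sum_(j < N.+3) x j * (shift_op (border_op x) j + border_op (shift_op x) j)
   = x N.+2 * (0 * x N.+2 + \sum_(k < N.+2) cross_row k * x k).
  have E1 : \sum_(k < N.+2) cross_row k * x k =
      x N + \sum_(k < N.+1) delta k * x k.+1.
    rewrite big_ord_recl /=.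
    have -> : \sum_(i < N.+1) (delta i + (i.+1 == N)%:R) * x i.+1 =
       \sum_(i < N.+1) delta i * x i.+1 + \sum_(i < N.+1) (i.+1 == N)%:R * x i.+1.
      by rewrite -big_split /=; apply: eq_bigr => i _; rewrite mulrDl.
    rewrite addrCA addrC; congr (_ + _).
    rewrite (_ : _ + _ = \sum_(i < N.+2) (i == N :> nat)%:R * x i); last first.
      by rewrite [RHS]big_ord_recl /= eq_sym.
    rewrite (bigD1 (Ordinal (leqnSn N.+1))) //= eqxx mul1r big1 ?addr0// => i.
    by rewrite -val_eqE /= => /negPf ->; rewrite mul0r.
  rewrite E1 mul0r add0r.
  rewrite [LHS]big_ord_recr [X in X + _ = _]big_ord_recr.
  rewrite [X in X + _ + _ = _]big_ord_recr /=.
  rewrite big1; last first.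
    move=> i _; have iN := ltn_ord i.
    by rewrite /shift_op /border_op !ltn_eqF ?addr0 ?if_same ?mulr0// !ltnS ?leqW// ltnW.
  rewrite /shift_op /border_op ltnSn !eqxx ltnn.
  rewrite (ltn_eqF (ltnSn N)) (ltn_eqF (leqnSn N.+1)) (gtn_eqF (ltnSn N.+1)).
  rewrite !(ltnNge N.+2) !leqnSn /= !add0r addr0 mulr0 addr0.
  rewrite (big_ord_recr N.+2) /= (big_ord_recr N.+1) /=.
  rewrite ltnn ltnNge leqnSn /= !mulr0 !addr0.
  have -> : \sum_(i < N.+1) delta i * (if (i < N.+1)%N then x i.+1 else 0)
     = \sum_(i < N.+1) delta i * x i.+1 by apply: eq_bigr => i _; rewrite ltn_ord.
  by ring.
rewrite [X in _ <= _ * X]big_ord_recr /= [X in _ <= _ * X]addrC.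
apply: (le_trans (ler_norm _)).
by apply: (@bordered_form_le _ N.+2 cross_row x) => //; rewrite mulr_gt0.
Qed.

Lemma companion_square_ge (r : R) (j : nat) : 0 <= r ->
  r ^+ N.+3 <= \sum_(k < N.+3) delta k * r ^+ k -> (j < N.+3)%N ->
  r ^+ 2 * r ^+ j <=
    shift_op (shift_op (GRing.exp r)) j + border_op (border_op (GRing.exp r)) j
    + (shift_op (border_op (GRing.exp r)) j + border_op (shift_op (GRing.exp r)) j).
Proof.
move=> r0 hr hj; set X := GRing.exp r; rewrite -/(X j).
have S0 k : 0 <= shift_op X k by rewrite /shift_op; case: ifP; rewrite ?exprn_ge0.
have Xr : r ^+ 2 * X j = r ^+ j.+2 by rewrite /X -exprD.
have B0 k : 0 <= border_op X k.
  rewrite /border_op; do 2?[case: ifP => _]; rewrite ?exprn_ge0//.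
  by apply: sumr_ge0 => i _; rewrite mulr_ge0 ?exprn_ge0.
(* This is [r X <= C X]: the last row is [hr], and the other rows hold because [X] is geometric. *)
have SB k : (k < N.+3)%N -> r * X k <= border_op X k + shift_op X k.
  rewrite /X -exprS ltnS leq_eqVlt => /orP[/eqP->|].
    by rewrite /border_op /shift_op gtn_eqF// eqxx ltnNge leqnSn addr0.
  rewrite ltnS leq_eqVlt => /orP[/eqP->|hk].
    by rewrite /border_op /shift_op eqxx ltnn addr0.
  by rewrite -[leLHS]add0r lerD ?B0// /shift_op hk.
rewrite Xr; move: hj; rewrite ltnS leq_eqVlt => /orP[/eqP->|].
  rewrite {1 3}/shift_op ltnNge leqnSn !add0r.
  rewrite {1 3}/border_op gtn_eqF// eqxx -big_split /=.
  (* In the last row [hr] is multiplied by [r], and [SB] then bounds each [r * X k] under the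
     sum. *)
  rewrite exprS; apply: (le_trans (ler_wpM2l r0 hr)).
  rewrite mulr_sumr; apply: ler_sum => k _.
  by rewrite mulrCA -mulrDr ler_wpM2l// SB.
rewrite ltnS leq_eqVlt => /orP[/eqP->|].
  rewrite {1 3}/shift_op ltnn !add0r {1 3}/border_op eqxx.
  by rewrite -[leLHS]addr0 lerD// /border_op gtn_eqF// eqxx.
rewrite ltnS => hj.
have Bj x : border_op x j = 0 by rewrite /border_op !ltn_eqF// ltnS// ltnW.
(* Row [N] gets its value from [A B], the rows above it from [A^2]. *)
rewrite !Bj !addr0 /shift_op !ltnS hj; move: hj; rewrite leq_eqVlt => /orP[/eqP->|hj].
  by rewrite ltnn add0r /border_op eqxx.
by rewrite hj -[leLHS]addr0 lerD ?B0.
Qed.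

(** The entrywise bound is paired with the nonnegative vector [X] and divided by [Q], which is
    positive since [X 0 = 1]. The term [(N == 0)%:R] lets degree three share the statement. *)
Lemma root_radius_le (r s1 s2 : R) : 0 <= r ->
  r ^+ N.+3 <= \sum_(k < N.+3) delta k * r ^+ k ->
  s1 = Num.sqrt (delta N.+2 ^+ 2
         + \sum_(k < N.+2) (delta k + (k == N.+1 :> nat)%:R) ^+ 2) ->
  0 < s2 ->
  s2 ^+ 2 = (N == 0)%:R + \sum_(k < N.+1) (delta k + (k.+1 == N)%:R) ^+ 2 ->
  r ^+ 2 <= cos (pi / N.+3%:R) ^+ 2 + 4^-1 * (delta N.+2 + s1) ^+ 2 + 2^-1 * s2.
Proof.
move=> r0 hr Es1 s20 hs2.
pose X := GRing.exp r; pose Q := \sum_(j < N.+3) X j ^+ 2.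
have Q0 : 0 < Q.
  rewrite /Q big_ord_recl /= ltr_pwDl ?expr1n//.
  by apply: sumr_ge0 => k _; exact: sqr_ge0.
have b0 : 0 < 2^-1 * (delta N.+2 + s1).
  rewrite mulr_gt0// ltr_wpDl// Es1 sqrtr_gt0 ltr_wpDl ?sqr_ge0//.
  rewrite big_ord_recr /= eqxx ltr_wpDl//.
    by apply: sumr_ge0 => k _; exact: sqr_ge0.
  by rewrite exprn_gt0// ltr_wpDl.
have c0 : 0 < cos (pi / N.+3%:R) :> R.
  have p0 := pi_gt0 R; apply: cos_gt0_pihalf; apply/andP; split.
    by rewrite (@lt_le_trans _ _ 0) ?oppr_lt0 ?divr_ge0 ?divr_gt0// ltW.
  by rewrite ltr_pM2l// ltf_pV2 ?posrE ?ltr0n// ltr_nat.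
have hA := quad_power_ineq X c0 shift_op_linear shift_op_bounded.
have := border_op_bounded; rewrite -Es1 => bB.
have hB := quad_power_ineq X b0 border_op_linear bB.
have hC := cross_form_le X s20 hs2.
rewrite -(ler_pM2r Q0).
have -> : (cos (pi / N.+3%:R) ^+ 2 + 4^-1 * (delta N.+2 + s1) ^+ 2 + 2^-1 * s2) * Q
  = cos (pi / N.+3%:R) ^+ 2 * Q + (2^-1 * (delta N.+2 + s1)) ^+ 2 * Q + 2^-1 * s2 * Q.
  by field.
apply: le_trans (lerD (lerD hA hB) hC).
rewrite -!big_split mulr_sumr /=; apply: ler_sum => j _.
rewrite -!mulrDr expr2 mulrCA; apply: ler_wpM2l; first exact: exprn_ge0.
exact: companion_square_ge.
Qed.

End CompanionSplitting.

(** * Moduli and the inequality satisfied by an inverse root *)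

Lemma normc_sum_le (R : rcfType) (m : nat) (F : nat -> R[i]) :
  normc (\sum_(k < m) F k) <= \sum_(k < m) normc (F k).
Proof.
elim: m => [|m IH]; first by rewrite !big_ord0 ComplexField.Normc.normc0.
rewrite !big_ord_recr /=; apply: (le_trans (le_normcD _ _)).
by rewrite lerD2r.
Qed.

Lemma normc_ge0 (R : rcfType) (w : R[i]) : 0 <= normc w.
Proof. by case: w => a b; exact: sqrtr_ge0. Qed.

Lemma normcX (R : rcfType) (w : R[i]) k : normc (w ^+ k) = normc w ^+ k.
Proof.
elim: k => [|k IH]; first by rewrite !expr0 ComplexField.Normc.normc1.
by rewrite !exprS ComplexField.Normc.normcM IH.
Qed.

Lemma normc_gt0 (R : rcfType) (w : R[i]) : w != 0 -> 0 < normc w.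
Proof.
move=> w0; rewrite lt_neqAle normc_ge0 andbT eq_sym.
by apply: contra w0 => /eqP /ComplexField.Normc.eq0_normc ->.
Qed.

Lemma inverse_root_ineq (R : realType) n (p : {poly R[i]}) (z : R[i]) :
  p \is monic -> size p = n.+1 -> p`_0 != 0 -> root p z ->
  (normc z)^-1 ^+ n <= \sum_(k < n) normc (d n p k%:Z) * (normc z)^-1 ^+ k.
Proof.
move=> /monicP mp hs p0 rz.
have z0 : z != 0.
  by apply: contra p0 => /eqP z0; move: rz; rewrite z0 rootE horner_coef0.
have nz := normc_gt0 z0; have np := normc_gt0 p0.
have E : p`_0 = - \sum_(i < n) p`_i.+1 * z ^+ i.+1.
  move: rz; rewrite rootE horner_coef hs big_ord_recl /= expr0 mulr1.
  by rewrite addr_eq0 => /eqP.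
have h : normc p`_0 <= \sum_(i < n) normc p`_i.+1 * normc z ^+ i.+1.
  rewrite {1}E (normcN (_ : Rcomplex R)).
  apply: (le_trans (normc_sum_le n (fun i => p`_i.+1 * z ^+ i.+1))).
  by apply: ler_sum => i _; rewrite ComplexField.Normc.normcM normcX.
rewrite -(ler_pM2r np) -[leLHS]mulrC.
apply: (le_trans (ler_wpM2r _ h)); first by rewrite exprn_ge0 ?invr_ge0 ?ltW.
(* Reversing the sum turns [p]_i.+1[into]p[_(n - i)], the numerator of [d_i]. *)
rewrite !mulr_suml (reindex_inj rev_ord_inj) /=; apply: ler_sum => i _.
rewrite /d subnSK //= ComplexField.Normc.normcM ComplexField.Normc.normcV.
have -> : (normc z)^-1 ^+ n = (normc z)^-1 ^+ (n - i) * (normc z)^-1 ^+ i.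
  by rewrite -exprD subnK // ltnW.
rewrite exprVn le_eqVlt; apply/orP; left; apply/eqP; field.
by rewrite expf_neq0 ?gt_eqF.
Qed.

(** * Matching the norms in [inv_beta] with those of the rows *)

(** For an index within range, the distinguished 1 becomes a Kronecker term in the sum, as in the
    rows of the splitting. *)
Lemma shifted_norm_nat (R : realType) n (p : {poly R[i]}) K m : (K < m)%N ->
  shifted_norm n p K%:Z m =
  Num.sqrt (\sum_(k < m) (normc (d n p k%:Z) + (k == K :> nat)%:R) ^+ 2).
Proof.
move=> Km; rewrite /shifted_norm big_mkord; congr Num.sqrt.
rewrite [RHS](bigD1 (Ordinal Km)) //= eqxx [1 + _]addrC; congr (_ + _).
by apply: eq_big => [i|i]; rewrite ?eqz_nat -?val_eqE// => /negPf ->; rewrite addr0.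
Qed.

Theorem theorem2p15 (R : realType) (n : nat) (p : {poly R[i]}) (beta : R)
    (hn : (3 <= n)%N) (hp : p \is monic) (hdeg : size p = n.+1)
    (hp0 : p`_0 != 0) (hbeta : 0 < beta)
    (hbetaE : beta^-1 = inv_beta n p) (z : R[i]) (hz : root p z) :
  beta <= normc z ^+ 2.
Proof.
have z0 : z != 0.
  by apply: contra hp0 => /eqP z0; move: hz; rewrite z0 rootE horner_coef0.
have nz := normc_gt0 z0.
suff : (normc z)^-1 ^+ 2 <= beta^-1.
  by rewrite exprVn lef_pV2 ?posrE ?exprn_gt0.
have hr := inverse_root_ineq hp hdeg hp0 hz.
case: n hn hdeg hbetaE hr => [|[|[|N]]] // _ hdeg -> hr.
pose delta k := normc (d N.+3 p k%:Z).
rewrite /inv_beta.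
have -> : N.+3%:Z - 1 = N.+2 by rewrite -addn1 PoszD addrK.
have -> : N.+3%:Z - 2 = N.+1 by rewrite -[N.+3]addn2 PoszD addrK.
rewrite subSS subSS subn0.
apply: (@root_radius_le R N delta) => //.
- by move=> k; exact: normc_ge0.
- by rewrite invr_ge0 ltW.
- by rewrite shifted_norm_nat// big_ord_recr /= gtn_eqF// addr0 addrC.
- rewrite sqrtr_gt0 -[ltLHS]addr0 ltr_leD//; last first.
    by apply: sumr_ge0 => k _; exact: sqr_ge0.
  by rewrite exprn_gt0// ltr_pwDl// normc_ge0.
- case: N @delta {hdeg hr} => [|N] delta.
    rewrite sqr_sqrtr; last first.
      by rewrite addr_ge0 ?sqr_ge0// sumr_ge0// => k _; exact: sqr_ge0.
    (* For [n = 3] the index is negative, so its coefficient is 0 and the 1 remains as the separate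
       term [(N == 0)%:R]. *)
    rewrite (_ : 3%:Z - 4 = Negz 0) // [X in normc X]/(d _ _ _).
    rewrite ComplexField.Normc.normc0 addr0 expr1n big_mkord; congr (_ + _).
    by apply: eq_bigr => k _; rewrite addr0.
  have -> : N.+4%:Z - 4 = N by rewrite -[N.+4]addn4 PoszD addrK.
  rewrite shifted_norm_nat; last by rewrite ltnS leqW.
  rewrite sqr_sqrtr ?add0r//.
  by apply: sumr_ge0 => k _; exact: sqr_ge0.
Qed.
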